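(* For the generic symmetric $n\times n$ matrix $X=(x_{ij})$, the ideal $\mathrm{Ann}(\mathrm{perm}(X))\subset S$ includes the following degree $2$ polynomials: (a) the monomials $y_{ii}y_{ij}$ for all $1\le i,j\le n$ ($i=j$ is allowed); the number of these monomials is $n^2$; (b) the binomials $y_{ij}^2-2y_{ii}y_{jj}$ ($i\ne j$), i.e. the $2\times2$ diagonal minors of $Y$ with a coefficient $2$ on the diagonal term; the number of these binomials is $\binom n2$; (c) the $2\times2$ minors of $Y$ with one diagonal element, i.e. $y_{ji}y_{il}-y_{jl}y_{ii}$ ($i,j,l$ pairwise distinct); the number of these binomials is $n\binom{n-1}{2}$.
   Context: Let $\mathsf k$ be an infinite field of characteristic zero or characteristic $p>2$. $X=(x_{ij})$ is the generic symmetric $n\times n$ matrix: its entries $x_{ij}=x_{ji}$, $1\le i\le j\le n$, are $n(n+1)/2$ distinct variables; $\mathrm{perm}(X)$ is its permanent. $R=\mathsf k[x_{ij}: i\le j]$ and $S=\mathsf k[y_{ij}: i\le j]$, with $y_{ij}=y_{ji}$; $Y=(y_{ij})$. $S$ acts on $R$ by differentiation: $y_{ij}$ acts as $\partial/\partial x_{ij}$, and the action of $h\in S$ on $F\in R$ is written $h\circ F$. $\mathrm{Ann}(F)=\{h\in S: h\circ F=0\}$. *)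

(* Defs.v *)
From HB Require Import structures.
From mathcomp Require Import all_boot all_order all_fingroup all_algebra.
From mathcomp Require Import finmap.
From mathcomp Require Import mpoly.

Set Implicit Arguments.
Unset Strict Implicit.
Unset Printing Implicit Defensive.

Import GRing.Theory.
Local Open Scope ring_scope.

Definition infinite_type (T : eqType) : Prop :=
  forall s : seq T, exists x : T, x \notin s.

Definition permanent (R : comNzRingType) (n : nat) (A : 'M[R]_n) : R :=
  \sum_(s : 'S_n) \prod_(i < n) A i (s i).

(* The variables of R and S are indexed by the pairs (i, j) with i <= j,      *)
(* numbered by enum_rank. R and S are two copies of                           *)
(* {mpoly k[nvars n]}, so x_ij and y_ij are the same term.                    *)
Definition upair (n : nat) := {p : 'I_n * 'I_n | (p.1 <= p.2)%N}.

Definition nvars (n : nat) : nat := #|{: upair n}|.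

Lemma upair_subproof (n : nat) (i j : 'I_n) :
  let p := if (i <= j)%N then (i, j) else (j, i) in (p.1 <= p.2)%N.
Proof. by case: leqP => //= /ltnW. Qed.

Definition mk_upair (n : nat) (i j : 'I_n) : upair n :=
  exist _ (if (i <= j)%N then (i, j) else (j, i)) (upair_subproof i j).

Definition varidx (n : nat) (i j : 'I_n) : 'I_(nvars n) :=
  enum_rank (mk_upair i j).

Definition gensym (k : fieldType) (n : nat) : 'M[{mpoly k[nvars n]}]_n :=
  \matrix_(i, j) 'X_(varidx i j).

Lemma mk_upairC (n : nat) (i j : 'I_n) : mk_upair i j = mk_upair j i.
Proof.
apply: val_inj => /=; case: ltngtP => // /val_inj eq_ij.
by rewrite eq_ij.
Qed.

Lemma gensym_sym (k : fieldType) (n : nat) : (gensym k n)^T = gensym k n.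
Proof. by apply/matrixP=> i j; rewrite !mxE /varidx mk_upairC. Qed.

Lemma card_nvars (n : nat) : nvars n = (n * n.+1)./2.
Proof.
rewrite /nvars card_sig -sum1_card.
rewrite (eq_bigl (fun p : 'I_n * 'I_n => true && (p.1 <= p.2)%N)) //.
rewrite -(pair_big_dep xpredT (fun i j : 'I_n => (i <= j)%N) (fun _ _ => 1%N)) /=.
rewrite (exchange_big_dep xpredT) //=.
rewrite (eq_bigr (fun j : 'I_n => j.+1)); last first.
  by move=> j _; rewrite (big_ord_narrow (ltn_ord j)) sum1_card card_ord.
rewrite mulnC -[n in (_ * n)%N]/(n.+1.-1) -bin2 -bin2_sum.
by rewrite big_nat_recl // add0n big_mkord.
Qed.

(* h o F: each variable acts as the corresponding partial derivative, so the  *)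
(* monomial 'X_[m] acts as the iterated derivative of multi-order m.          *)
Definition dact (k : fieldType) (N : nat) (h F : {mpoly k[N]}) : {mpoly k[N]} :=
  \sum_(m <- msupp h) h@_m *: F^`M[m].

Definition Ann (k : fieldType) (N : nat) (F : {mpoly k[N]}) :
    {pred {mpoly k[N]}} :=
  [pred h | dact h F == 0].

Definition monomials_a (k : fieldType) (n : nat) : {fset {mpoly k[nvars n]}} :=
  let Y := gensym k n in
  [fset Y i i * Y i j | i : 'I_n, j : 'I_n]%fset.

Definition binomials_b (k : fieldType) (n : nat) : {fset {mpoly k[nvars n]}} :=
  let Y := gensym k n in
  [fset Y i j ^+ 2 - 2%:R * Y i i * Y j j
     | i : 'I_n, j : 'I_n & i != j]%fset.

Definition binomials_c (k : fieldType) (n : nat) : {fset {mpoly k[nvars n]}} :=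
  let Y := gensym k n in
  [fset (let: (i, j, l) := t in Y j i * Y i l - Y j l * Y i i)
     | t : 'I_n * 'I_n * 'I_n
     & let: (i, j, l) := t in [&& i != j, i != l & j != l]]%fset.

(* Main.v *)
Require Import Defs.
From HB Require Import structures.
From mathcomp Require Import all_boot all_order all_fingroup all_algebra.
From mathcomp Require Import finmap.
From mathcomp Require Import ssrcomplements mpoly.

Set Implicit Arguments.
Unset Strict Implicit.
Unset Printing Implicit Defensive.

Import GRing.Theory.
Local Open Scope ring_scope.

(** Expand the permanent of the generic symmetric matrix as a sum over
    permutations and differentiate it twice, with respect to the variables
    u and v.  Since every entry is a single variable, the result
    ([mderiv2_permanent]) is the sum, over all ordered pairs of cells
    x = (a, c) carrying u and y = (b, d) carrying v, of the permanent of the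
    matrix with rows a, b and columns c, d removed ([minor2 x y]).  An
    off-diagonal variable sits in two cells, a diagonal one in a single cell.
    Three facts about these reduced permanents give all the relations:
    they vanish when the two cells share a row or a column; they depend only on
    the unordered pair of cells; and exchanging the two columns does not change
    them, as there are no signs in a permanent.  Then

    - y_ii y_ij kills the permanent because the cell of y_ii shares a row or a
      column with each cell of y_ij;
    - y_ij^2 gives the permanent without rows and columns i, j twice, once for
      each order of the cells (i, j) and (j, i), while y_ii y_jj gives it once;
    - y_ji y_il leaves the cell pairs (i, j), (l, i) and (j, i), (i, l), whose
      reduced permanents become, after exchanging columns, those of the cell
      pairs (l, j), (i, i) and (j, l), (i, i) of y_jl y_ii.

    For the counts, distinct quadratic monomials are told apart by their
    unordered pair of variables, and in the binomials the monomial y_ij^2 or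
    y_ji y_il can be recovered as the one that contains no diagonal variable.
    So the ordered pairs (i, j), respectively the triples
    (i, j, l), that give the same binomial are related by exchanging i with j,
    respectively j with l: each binomial is counted exactly twice
    ([card_constant_fibres]). *)

(** * The cells that carry a given variable *)

Lemma mk_upair_eq (n : nat) (i j p q : 'I_n) :
  (mk_upair i j == mk_upair p q) =
  ((i == p) && (j == q) || (i == q) && (j == p)).
Proof.
apply/idP/idP=> [/eqP /(congr1 val) /=|]; last first.
  by case/orP=> /andP[/eqP-> /eqP->]; rewrite // mk_upairC.
by case: ifP => _; case: ifP => _ [-> ->]; rewrite !eqxx ?orbT.
Qed.

Lemma varidxC (n : nat) (i j : 'I_n) : varidx i j = varidx j i.
Proof. by rewrite /varidx mk_upairC. Qed.

Lemma varidx_eq (n : nat) (i j p q : 'I_n) :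
  (varidx i j == varidx p q) =
  ((i == p) && (j == q) || (i == q) && (j == p)).
Proof. by rewrite (inj_eq enum_rank_inj) mk_upair_eq. Qed.

(** The two cells (p, q) and (q, p) of an off-diagonal variable collapse to one
    on the diagonal, hence the conditional second term. *)
Lemma big_cells (V : nmodType) (n : nat) (p q : 'I_n) (f : 'I_n * 'I_n -> V) :
  \sum_(x | varidx x.1 x.2 == varidx p q) f x =
  f (p, q) + (if p == q then 0 else f (q, p)).
Proof.
rewrite (bigD1 (p, q)) ?eqxx //=; congr (_ + _).
case: (eqVneq p q) => [<-|npq].
  by rewrite big_pred0 // => -[i j]; rewrite varidx_eq orbb xpair_eqE andbN.
rewrite (big_pred1 (q, p)) // => -[i j] /=; rewrite varidx_eq !xpair_eqE.
case: (i =P p) => [->|_] /=; last by rewrite andbT.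
by rewrite (negbTE npq) /= orbF andbN.
Qed.

(** * Second derivatives of the permanent *)

Lemma mderiv_prod (R : comNzRingType) (N : nat) (u : 'I_N) (I : finType)
    (P : pred I) (F : I -> {mpoly R[N]}) :
  (\prod_(i | P i) F i)^`M(u) =
  \sum_(i | P i) (F i)^`M(u) * \prod_(j | P j && (j != i)) F j.
Proof.
(* Induction on the number of factors, peeling off one factor i0. *)
have [m] := ubnP #|P|; elim: m P => // m IHm P /ltnSE le_m.
case: (pickP P) => [i0 Pi0|P0]; last first.
  by rewrite !big_pred0 // -mpolyC1 mderivC.
have lt_m : (#|[pred j | P j && (j != i0)]| < m)%N.
  apply: leq_trans le_m; apply: proper_card; apply/properP; split.
    by apply/subsetP=> j /andP[].
  by exists i0; rewrite // inE eqxx andbF.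
rewrite (bigD1 i0) //= mderivM (IHm _ lt_m) [RHS](bigD1 i0) //=.
congr (_ + _); rewrite mulr_sumr; apply: eq_bigr => i /andP[Pi ni].
rewrite mulrCA; congr (_ * _).
rewrite [RHS](bigD1 i0) /=; last by rewrite Pi0 eq_sym.
by congr (_ * _); apply: eq_bigl => j; rewrite -!andbA [(_ != i0) && _]andbC.
Qed.

Lemma mderivXU (R : comNzRingType) (N : nat) (u v : 'I_N) :
  ('X_v : {mpoly R[N]})^`M(u) = (v == u)%:R.
Proof.
rewrite mderivX mnm1E; case: eqVneq => [->|_]; last by rewrite scale0r.
by rewrite -[X in (X - _)%MM]add0m addmK mpolyX0 scale1r.
Qed.

(** The permanent of A with the rows and the columns of the cells x and y
    removed, written as a sum over the permutations that pass through x and y: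
    this avoids reindexing, and makes the value 0 when x and y share a row or a
    column. *)
Definition minor2 (R : comNzRingType) (n : nat) (A : 'M[R]_n)
    (x y : 'I_n * 'I_n) : R :=
  \sum_(s : 'S_n | [&& x.1 != y.1, s x.1 == x.2 & s y.1 == y.2])
    \prod_(i | (i != x.1) && (i != y.1)) A i (s i).

Section Minor2.
Variables (R : comNzRingType) (n : nat) (A : 'M[R]_n).

Lemma minor2C x y : minor2 A x y = minor2 A y x.
Proof.
apply: eq_big => s; first by rewrite eq_sym [(s x.1 == _) && _]andbC.
by move=> _; apply: eq_bigl => i; rewrite andbC.
Qed.

Lemma minor2_row a c d : minor2 A (a, c) (a, d) = 0.
Proof. by rewrite /minor2 big_pred0 // => s /=; rewrite eqxx. Qed.

Lemma minor2_col a b c : minor2 A (a, c) (b, c) = 0.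
Proof.
rewrite /minor2 big_pred0 // => s /=; apply/and3P=> -[nab /eqP sa /eqP sb].
by case/eqP: nab; apply: (@perm_inj _ s); rewrite sa sb.
Qed.

(** Composing with the transposition of the rows a and b exchanges the
    permutations through (a, c), (b, d) with those through (a, d), (b, c), and
    leaves the other rows alone. *)
Lemma minor2_swap a b c d : minor2 A (a, c) (b, d) = minor2 A (a, d) (b, c).
Proof.
rewrite /minor2 (reindex_inj (mulgI (tperm a b))) /=.
apply: eq_big => s; first by rewrite !permM tpermL tpermR [(_ == c) && _]andbC.
by move=> _; apply: eq_bigr => i /andP[ia ib]; rewrite permM tpermD // eq_sym.
Qed.
End Minor2.

(** Used to trade a sum over permutations of sums over rows for a sum over
    cells: the cells met by a permutation are the points of its graph. *)
Lemma big_graph (V : nmodType) (T : finType) (s : T -> T) (P : pred (T * T))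
    (f : T * T -> V) :
  \sum_(x | P x && (s x.1 == x.2)) f x = \sum_(a | P (a, s a)) f (a, s a).
Proof.
rewrite (reindex_onto (fun a => (a, s a)) (fun x => x.1)) /=.
  by apply: eq_bigl => a; rewrite !eqxx !andbT.
by move=> [a c] /andP[_ /eqP /= <-].
Qed.

(** In the term of a permutation s, differentiating with respect to u erases in
    turn each factor x_(a, s a) equal to u, and then v erases a factor in a
    different row b; exchanging the sums groups the permutations by the two
    cells erased. *)
Lemma mderiv2_permanent (k : fieldType) (n : nat) (u v : 'I_(nvars n)) :
  (permanent (gensym k n))^`M(u)^`M(v) =
  \sum_(x | varidx x.1 x.2 == u) \sum_(y | varidx y.1 y.2 == v)
    minor2 (gensym k n) x y.
Proof.
(* cell s w i is the derivative of the entry x_(i, s i) with respect to w. *)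
pose cell (s : 'S_n) (w : 'I_(nvars n)) (i : 'I_n) : {mpoly k[nvars n]} :=
  (varidx i (s i) == w)%:R.
pose T (s : 'S_n) a b : {mpoly k[nvars n]} :=
  \prod_(i | (i != a) && (i != b)) gensym k n i (s i).
have D1 (s : 'S_n) (w : 'I_(nvars n)) (P : pred 'I_n) :
  (\prod_(i | P i) gensym k n i (s i))^`M(w) =
  \sum_(i | P i) cell s w i * \prod_(j | P j && (j != i)) gensym k n j (s j).
  by rewrite mderiv_prod; apply: eq_bigr => i _; rewrite mxE mderivXU.
transitivity (\sum_(s : 'S_n) \sum_a \sum_(b | b != a)
                cell s u a * (cell s v b * T s a b)).
  rewrite /permanent (raddf_sum (mderiv u)) /= (raddf_sum (mderiv v)) /=.
  apply: eq_bigr => s _.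
  rewrite D1 (raddf_sum (mderiv v)) /=; apply: eq_bigr => a _.
  by rewrite /cell -mpolyC_nat mderiv_mulC D1 mulr_sumr.
under [RHS]eq_bigr => x _ do rewrite (exchange_big_dep xpredT) //=.
rewrite [RHS]exchange_big /=; apply: eq_bigr => s _.
transitivity (\sum_(a | varidx a (s a) == u)
  \sum_(b | (b != a) && (varidx b (s b) == v)) T s a b).
  rewrite [RHS]big_mkcond; apply: eq_bigr => a _ /=; rewrite -mulr_sumr /cell.
  case: ifP => _; last by rewrite mul0r.
  rewrite mul1r [RHS]big_mkcondr; apply: eq_bigr => b _.
  by case: ifP => _; rewrite ?mul1r ?mul0r.
rewrite -(big_graph s (fun x => varidx x.1 x.2 == u)
  (fun x => \sum_(b | (b != x.1) && (varidx b (s b) == v)) T s x.1 b)).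
rewrite big_mkcondr; apply: eq_bigr => -[a c] _ /=.
case: ifP => _; last by rewrite big_pred0 // => y; rewrite !andbF.
rewrite -(big_graph s (fun y => (y.1 != a) && (varidx y.1 y.2 == v))
  (fun y => T s a y.1)).
by apply: eq_bigl => y /=; rewrite [(y.1 != a) && _]andbC [a == _]eq_sym -andbA.
Qed.

(** * The action by differentiation *)

(** Linearity in h is hidden by the support of h as summation range; a range
    that depends only on a degree bound can be shared by several polynomials. *)
Lemma dact_trunc (k : fieldType) (N d : nat) (h F : {mpoly k[N]}) :
  (msize h <= d)%N ->
  dact h F = \sum_(m : 'X_{1..N < d}) h@_m *: F^`M[m].
Proof.
move=> le_hd; pose I : subFinType _ := 'X_{1..N < d}.
rewrite /dact (big_mksub I) /=; first last.
- by move=> m /msize_mdeg_lt /leq_trans; apply.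
- exact: msupp_uniq.
by rewrite big_rmcond //= => m /memN_msupp_eq0 ->; rewrite scale0r.
Qed.

Lemma dact_is_linear (k : fieldType) (N : nat) (F : {mpoly k[N]}) :
  linear (fun h : {mpoly k[N]} => dact h F).
Proof.
move=> c p q; set d := maxn (msize (c *: p + q)) (maxn (msize p) (msize q)).
rewrite !(@dact_trunc _ _ d) ?leq_maxl //; last 2 first.
- by rewrite !leq_max leqnn !orbT.
- by rewrite !leq_max leqnn !orbT.
rewrite scaler_sumr -big_split; apply: eq_bigr => m _ /=.
by rewrite mcoeffD mcoeffZ scalerDl scalerA.
Qed.

Lemma dactX (k : fieldType) (N : nat) (m : 'X_{1..N}) (F : {mpoly k[N]}) :
  dact 'X_[m] F = F^`M[m].
Proof. by rewrite /dact msuppX big_seq1 mcoeffX eqxx scale1r. Qed.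

(** * Counting the image of a map with fibres of constant size *)

Lemma card_constant_fibres (T : finType) (K : choiceType) (S : {fset K})
    (f : T -> K) (P : pred T) (m : nat) :
  (forall y, y \in S <-> exists2 x, P x & f x = y) ->
  (forall x, P x -> #|[pred z | P z && (f z == f x)]| = m) ->
  #|P| = (m * #|` S|)%N.
Proof.
move=> defS fibre.
transitivity (\sum_(y : S) #|[pred z | P z && (f z == val y)]|)%N.
  rewrite -sum1_card.
  have inS x : P x -> f x \in S by move=> Px; apply/defS; exists x.
  case: (pickP P) => [x0 Px0|P0]; last first.
    rewrite big_pred0 // big1 // => y _; apply: eq_card0 => z.
    by rewrite inE P0.
  pose g x : S := insubd [` inS _ Px0]%fset (f x).
  rewrite (partition_big g xpredT) //=; apply: eq_bigr => y _.
  rewrite sum1_card; apply: eq_card => z; rewrite !inE /=.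
  transitivity (P z && (g z == y)) => //; case Pz: (P z) => //=.
  by rewrite -(inj_eq val_inj) val_insubd inS.
transitivity (\sum_(y : S) m)%N; last by rewrite sum_nat_const cardfE mulnC.
apply: eq_bigr => y _; have /defS[x Px <-] := valP y; exact: fibre.
Qed.

(** * Quadratic monomials and binomials *)

Lemma mnm2_eq (N : nat) (a b c d : 'I_N) :
  (U_(a) + U_(b) == U_(c) + U_(d))%MM =
  ((a == c) && (b == d) || (a == d) && (b == c)).
Proof.
case: (eqVneq a c) => [->|nac] /=.
  rewrite eqm_add2l eq_mnm1; case: (eqVneq b d) => //= nbd.
  by apply/esym/andP=> -[/eqP cd /eqP bc]; rewrite bc cd eqxx in nbd.
case: (eqVneq a d) => [->|nad] /=; first by rewrite addmC eqm_add2r eq_mnm1.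
apply/negP=> /eqP /mnmP /(_ a); rewrite !mnmDE !mnm1E eqxx.
by rewrite [c == a]eq_sym (negbTE nac) [d == a]eq_sym (negbTE nad).
Qed.

Section Quadrics.
Variables (R : comNzRingType) (N : nat).
Implicit Types (m : 'X_{1..N}) (c : R).

Lemma mpolyX_inj : injective (fun m => 'X_[R, m]).
Proof. by move=> m m' /(congr1 (@msupp N R)); rewrite !msuppX => -[]. Qed.

Lemma msize_quadratic (a b p q : 'I_N) c :
  (U_(a) + U_(b) != U_(p) + U_(q))%MM ->
  msize ('X_[U_(a) + U_(b)] - c *: 'X_[U_(p) + U_(q)]) = 3%N.
Proof.
set m1 := (X in X != _); set m2 := (X in _ != X); move=> nm.
set h := _ - _.
have hom : h \is 2.-homog.
  by rewrite rpredB ?rpredZ // dhomogX /= /m1 /m2 mdegD !mdeg1.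
have h_neq0 : h != 0.
  apply/eqP=> /(congr1 (mcoeff m1)); rewrite mcoeffB mcoeffZ !mcoeffX mcoeff0.
  rewrite eqxx eq_sym (negbTE nm) mulr0 subr0 => /eqP; exact/negP/oner_neq0.
have := dhomog_uniq h_neq0 hom (dhomog_msize hom).
by case: (msize h) => // d /= <-.
Qed.

(** As m1 differs from both subtracted monomials, its coefficient on the left is
    1, so it can only come from m1' on the right; this holds for every c. *)
Lemma eq_binomial_lead m1 m2 m1' m2' c :
  m1 != m2 -> m1 != m2' ->
  'X_[m1] - c *: 'X_[m2] = 'X_[m1'] - c *: 'X_[m2'] -> m1 = m1'.
Proof.
move=> n12 n12' /(congr1 (mcoeff m1)); rewrite !mcoeffB !mcoeffZ !mcoeffX.
rewrite eqxx [m2 == _]eq_sym [m2' == _]eq_sym (negbTE n12) (negbTE n12').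
rewrite !mulr0 !subr0; case: eqP => // _ /eqP.
by rewrite oner_eq0.
Qed.
End Quadrics.

(** * Relations and their number *)

Section Annihilator.
Variables (k : fieldType) (n : nat).
Local Notation Y := (gensym k n).
Local Notation M := (minor2 Y).
Local Notation q2 i j p q := (U_(@varidx n i j) + U_(@varidx n p q))%MM.

Lemma gensymM i j p q : Y i j * Y p q = 'X_[q2 i j p q].
Proof. by rewrite !mxE mpolyXD. Qed.

Lemma dact_quadratic i j p q :
  dact 'X_[q2 i j p q] (permanent Y) =
  M (i, j) (p, q) + (if p == q then 0 else M (i, j) (q, p)) +
  (if i == j then 0
   else M (j, i) (p, q) + (if p == q then 0 else M (j, i) (q, p))).
Proof. by rewrite dactX mderivmDm !mderivmU1m mderiv2_permanent !big_cells. Qed.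

Lemma diagonal_mul_Ann i j : 'X_[q2 i i i j] \in Ann (permanent Y).
Proof.
rewrite inE dact_quadratic eqxx addr0 minor2_row minor2_col add0r.
by case: ifP.
Qed.

Lemma diagonal_minor_Ann i j : i != j ->
  'X_[q2 i j i j] - 2%:R *: 'X_[q2 i i j j] \in Ann (permanent Y).
Proof.
move=> nij; rewrite inE addrC -scaleNr dact_is_linear !dact_quadratic !eqxx.
rewrite (negbTE nij) !minor2_row !addr0 add0r (minor2C _ (j, i)).
by rewrite (minor2_swap _ i j j) scaleNr scaler_nat mulr2n addNr.
Qed.

Lemma mixed_minor_Ann i j l : i != j -> i != l -> j != l ->
  'X_[q2 j i i l] - 1 *: 'X_[q2 j l i i] \in Ann (permanent Y).
Proof.
move=> nij nil njl; rewrite inE addrC -scaleNr dact_is_linear !dact_quadratic.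
rewrite eqxx [j == i]eq_sym (negbTE nij) (negbTE nil) (negbTE njl).
rewrite minor2_col minor2_row !addr0 add0r scaleN1r.
rewrite (minor2_swap _ j i i l) (minor2C _ (i, j)) (minor2_swap _ l i i j).
by rewrite addNr.
Qed.

Lemma monomials_aP y :
  y \in monomials_a k n <->
  exists2 x, predT x & 'X_[q2 x.1 x.1 x.1 x.2] = y.
Proof.
split=> [/imfset2P[i _ [j _ ->]]|[[i j] _ <-]].
  by exists (i, j); rewrite //= gensymM.
by apply/imfset2P; exists i => //; exists j; rewrite //= gensymM.
Qed.

Lemma binomials_bP y :
  y \in binomials_b k n <->
  exists2 x : 'I_n * 'I_n, x.1 != x.2
    & 'X_[q2 x.1 x.2 x.1 x.2] - 2%:R *: 'X_[q2 x.1 x.1 x.2 x.2] = y.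
Proof.
have E i j : Y i j ^+ 2 - 2%:R * Y i i * Y j j =
    'X_[q2 i j i j] - 2%:R *: 'X_[q2 i i j j].
  by rewrite expr2 -mulrA !gensymM mulr_natl scaler_nat.
split=> [/imfset2P[i _ [j /= nij ->]]|[[i j] /= nij <-]].
  by exists (i, j); rewrite //= E.
by apply/imfset2P; exists i => //; exists j; rewrite //= E.
Qed.

Lemma binomials_cP y :
  y \in binomials_c k n <->
  exists2 x : 'I_n * 'I_n * 'I_n,
    [&& x.1.1 != x.1.2, x.1.1 != x.2 & x.1.2 != x.2]
    & 'X_[q2 x.1.2 x.1.1 x.1.1 x.2] - 1 *: 'X_[q2 x.1.2 x.2 x.1.1 x.1.1] = y.
Proof.
split=> [/imfsetP[[[i j] l] /= nijl ->]|[[[i j] l] /= nijl <-]].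
  by exists (i, j, l); rewrite //= !gensymM scale1r.
by apply/imfsetP; exists (i, j, l); rewrite //= !gensymM scale1r.
Qed.

(** The separation of the two monomials of a binomial, also across different
    binomials of the same family: only one side has a diagonal variable. *)
Lemma square_neq_diagonals i j p q : i != j -> q2 i j i j != q2 p p q q.
Proof.
move=> nij; rewrite mnm2_eq !varidx_eq; apply/negP.
by case/orP=> /andP[]; rewrite !orbb => /andP[/eqP ip /eqP jp];
   rewrite ip jp eqxx in nij.
Qed.

Lemma offdiagonal_neq_diagonal i j l p q r :
  i != j -> i != l -> q2 j i i l != q2 p q r r.
Proof.
move=> nij nil; rewrite mnm2_eq !varidx_eq; apply/negP; rewrite !orbb.
case/orP=> /andP[].
  by move=> _ /andP[/eqP ir /eqP lr]; rewrite ir lr eqxx in nil.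
by move=> /andP[/eqP jr /eqP ir]; rewrite ir jr eqxx in nij.
Qed.

Lemma card_pairs : #|[pred x : 'I_n * 'I_n | x.1 != x.2]| = (n * n.-1)%N.
Proof.
rewrite -sum1_card.
rewrite -(pair_big_dep xpredT (fun i j => i != j) (fun _ _ => 1%N)) /=.
rewrite -[in RHS](card_ord n) -sum_nat_const; apply: eq_bigr => i _.
rewrite sum1_card -(cardC1 i); apply: eq_card => j.
by rewrite !inE eq_sym.
Qed.

Lemma card_triples :
  #|[pred x : 'I_n * 'I_n * 'I_n
      | [&& x.1.1 != x.1.2, x.1.1 != x.2 & x.1.2 != x.2]]|
  = (n * n.-1 * n.-2)%N.
Proof.
rewrite -card_pairs -sum_nat_const -sum1_card.
rewrite -(pair_big_dep (fun x => x.1 != x.2)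
  (fun x l => (x.1 != l) && (x.2 != l)) (fun _ _ => 1%N)) /=.
apply: eq_bigr => -[i j] /= nij; rewrite sum1_card.
have := cardC (pred2 i j); rewrite card2 nij card_ord.
move/(congr1 (fun m => m.-2)) => /= <-.
by apply: eq_card => l; rewrite !inE negb_or ![l == _]eq_sym.
Qed.

Lemma card_monomials_a : #|` monomials_a k n|%fset = (n ^ 2)%N.
Proof.
have := card_constant_fibres (m := 1) monomials_aP; rewrite mul1n => <-.
  by rewrite cardT -cardE card_prod !card_ord mulnn.
move=> [i j] _; rewrite -(card1 (i, j)); apply: eq_card => -[p q].
rewrite !inE /= (inj_eq (@mpolyX_inj _ _)) mnm2_eq !varidx_eq xpair_eqE.
case: (eqVneq p i) => [->|npi] /=; rewrite ?orbb.
  case: (eqVneq q j) => [->|nqj] /=; rewrite ?eqxx //=.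
  by case: (eqVneq i j) nqj => [<-|_] /=; case: (q == i).
by rewrite andbF.
Qed.

Lemma card_binomials_b : #|` binomials_b k n|%fset = 'C(n, 2).
Proof.
have := card_constant_fibres (m := 2) binomials_bP.
rewrite card_pairs -[X in (_ * X)%N]bin1 mul_bin_diag => H.
apply/eqP; rewrite -(eqn_pmul2l (isT : 0 < 2)%N) -H // => -[i j] /= nij.
transitivity #|pred2 (i, j) (j, i)|.
  apply: eq_card => -[p q]; rewrite !inE /= !xpair_eqE.
  apply/andP/idP=> [[npq /eqP E]|].
    have /eqP := eq_binomial_lead (square_neq_diagonals p q npq)
      (square_neq_diagonals i j npq) E.
    by rewrite mnm2_eq varidx_eq orbb andbb.
  case/orP=> /andP[/eqP-> /eqP->]; rewrite ?nij ?eqxx //.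
  by rewrite eq_sym nij (varidxC j i) [(U_(varidx j j) + _)%MM]addmC.
by rewrite card2 xpair_eqE (negbTE nij).
Qed.

Lemma card_binomials_c : #|` binomials_c k n|%fset = (n * 'C(n.-1, 2))%N.
Proof.
have := card_constant_fibres (m := 2) binomials_cP.
rewrite card_triples -mulnA -[X in (_ * (_ * X))%N]bin1 mul_bin_diag mulnCA.
move=> H.
apply/eqP; rewrite -(eqn_pmul2l (isT : 0 < 2)%N) -H // => -[[i j] l] /=.
case/and3P=> nij nil njl.
transitivity #|pred2 (i, j, l) (i, l, j)|.
  apply: eq_card => -[[p q] r]; rewrite !inE /= !xpair_eqE.
  apply/andP/idP=> [[/and3P[npq npr nqr] /eqP E]|].
    have /eqP := eq_binomial_lead
      (offdiagonal_neq_diagonal _ _ _ npq npr)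
      (offdiagonal_neq_diagonal _ _ _ npq npr) E.
    rewrite mnm2_eq !varidx_eq.
    (* If p <> i, two indices of one of the triples coincide. *)
    by case/orP=> /andP[/orP[]/andP[/eqP ? /eqP ?] /orP[]/andP[/eqP ? /eqP ?]];
      subst; move: npr nqr nij njl; rewrite ?eqxx ?orbT.
  case/orP=> /andP[/andP[/eqP-> /eqP->] /eqP->].
    by rewrite nij nil njl eqxx.
  rewrite nij nil [l == j]eq_sym njl; split=> //.
  by rewrite (varidxC l i) (varidxC i j) (varidxC l j) addmC.
by rewrite card2 !xpair_eqE (negbTE njl) andbF.
Qed.

End Annihilator.

Theorem proposition3p12 (k : fieldType) (n : nat)
    (k_infinite : infinite_type k)
    (k_char : [pchar k] =i pred0 \/ exists2 p : nat, (2 < p)%N & p \in [pchar k]) :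
  [/\ (forall h : {mpoly k[nvars n]}, h \in monomials_a k n ->
         h \in Ann (permanent (gensym k n)) /\ msize h = 3%N)
      /\ #|` monomials_a k n|%fset = (n ^ 2)%N,
      (forall h : {mpoly k[nvars n]}, h \in binomials_b k n ->
         h \in Ann (permanent (gensym k n)) /\ msize h = 3%N)
      /\ #|` binomials_b k n|%fset = 'C(n, 2)
    & (forall h : {mpoly k[nvars n]}, h \in binomials_c k n ->
         h \in Ann (permanent (gensym k n)) /\ msize h = 3%N)
      /\ #|` binomials_c k n|%fset = (n * 'C(n.-1, 2))%N].
Proof.
split; split.
- move=> h /monomials_aP[[i j] _ <-]; split; first exact: diagonal_mul_Ann.
  by rewrite msizeX mdegD !mdeg1.
- exact: card_monomials_a.
- move=> h /binomials_bP[[i j] /= nij <-].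
  split; first exact: diagonal_minor_Ann.
  exact/msize_quadratic/square_neq_diagonals.
- exact: card_binomials_b.
- move=> h /binomials_cP[[[i j] l] /= /and3P[nij nil njl] <-].
  split; first exact: mixed_minor_Ann.
  exact/msize_quadratic/offdiagonal_neq_diagonal.
- exact: card_binomials_c.
Qed.
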